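(* Let $\hat\theta\in\mathbb{R}^D$, let $\Sigma\in\mathbb{R}^{D\times D}$ be symmetric positive definite, and let the target density be Gaussian, $\pi(\theta)=\mathcal{N}(\theta\mid\hat\theta,\Sigma)$, with $\ell=\log\pi$ (so that $\hat\theta$ is the MAP estimate and $\Sigma=(-\nabla^2\ell(\hat\theta))^{-1}$). Let $\mathcal{P}$ and $\mathcal{M}$ be the Riemannian manifolds given by $\mathbb{R}^D$ with the metric coefficient matrices $$G_{\mathcal{P}}(\theta)=I_D+\nabla\log\mathcal{N}(\theta\mid\hat\theta,\Sigma)\,\nabla\log\mathcal{N}(\theta\mid\hat\theta,\Sigma)^\top,\qquad G_{\mathcal{M}}(\theta)=I_D+\nabla\ell(\theta)\nabla\ell(\theta)^\top.$$ Then the Riemannian Laplace approximation with logarithmic map is exact: if $\bar\theta\sim\mathcal{N}(\hat\theta,\Sigma)$, then $\mathrm{Exp}_{\mathcal{M},\hat\theta}(\mathrm{Log}_{\mathcal{P},\hat\theta}(\bar\theta))$ has distribution exactly $\pi$.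
   Context: $\mathcal{N}(\theta\mid m,\Sigma)$ is the Gaussian density with mean $m$ and covariance $\Sigma$. $\mathrm{Exp}_{\mathcal{M},\hat\theta}(v)$ is the time-$1$ position of the geodesic of $\mathcal{M}$ (Levi-Civita connection) starting at $\hat\theta$ with velocity $v$, and similarly for $\mathcal{P}$. $\mathrm{Log}_{\mathcal{P},\hat\theta}(\bar\theta)$ is a tangent vector $v$ at $\hat\theta$ minimizing $v^\top G_{\mathcal{P}}(\hat\theta)v$ subject to $\mathrm{Exp}_{\mathcal{P},\hat\theta}(v)=\bar\theta$ (any minimizer if there are several). For a general target $\pi$ with log-density $\ell$ and mode $\hat\theta$ the approximation is the distribution of $\mathrm{Exp}_{\mathcal{M},\hat\theta}(\mathrm{Log}_{\mathcal{P},\hat\theta}(\bar\theta))$ with $\bar\theta\sim\mathcal{N}(\hat\theta,\Sigma)$, $\Sigma=(-\nabla^2\ell(\hat\theta))^{-1}$. *)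

(* Defs.v *)
From HB Require Import structures.
From mathcomp Require Import all_boot all_order all_algebra.
From mathcomp Require Import all_classical all_reals all_analysis.

Set Implicit Arguments.
Unset Strict Implicit.
Unset Printing Implicit Defensive.
Import Order.TTheory GRing.Theory Num.Theory.
Import numFieldNormedType.Exports.

Local Open Scope classical_set_scope.
Local Open Scope ring_scope.

(* Points and tangent vectors of R^D are column vectors; for measure theory   *)
(* R^D carries the sigma-algebra generated by its open sets.                  *)
Notation borelV R D := (g_sigma_algebraType (@open 'cV[R]_D)).

Section lebesgue_cV.
Variable R : realType.

Lemma measurable_coord D (i : 'I_D) :
  measurable_fun [set: borelV R D] (fun v : borelV R D => (v : 'cV[R]_D) i 0).
Proof.
apply: (measurability _ (measurable_realfun.RGenOpens.measurableE R)).
move=> _ [_ [a [b ->]] <-].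
rewrite setTI; apply: sub_sigma_algebra.
apply: (@open_comp 'cV[R]_D R); last exact: interval_open.
by move=> v _; exact: coord_continuous.
Qed.

Lemma measurable_borelV d (T : measurableType d) D (f : T -> borelV R D) :
  (forall i, measurable_fun setT (fun t => (f t : 'cV[R]_D) i 0)) ->
  measurable_fun setT f.
Proof.
move=> mf; apply: (@measurability _ _ T (borelV R D) setT f (@open 'cV[R]_D) erefl) => _ [U oU <-].
pose B (q : 'cV[rat]_D * nat) : set 'cV[R]_D :=
  [set v | forall i, `|v i 0 - ratr (q.1 i 0)| < q.2.+1%:R^-1].
have -> : U = \bigcup_q [set v | B q `<=` U /\ B q v].
  apply/seteqP; split=> [v Uv|v [q _ [+ Bv]]]; last exact.
  have /nbhs_ballP[e /= e0 eU] : nbhs (v : 'cV[R]_D) U.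
    exact: open_nbhs_nbhs.
  have [n ne] : exists n : nat, n.+1%:R^-1 < e / 2.
    have := near_infty_natSinv_lt (PosNum (divr_gt0 e0 (ltr0n R 2))).
    by case=> n _ /(_ n (leqnn n)) /= ?; exists n.
  have n0 : 0 < n.+1%:R^-1 :> R by rewrite invr_gt0.
  have /choice[q qv] : forall i : 'I_D, exists r : rat,
      `|(v : 'cV[R]_D) i 0 - ratr r| < n.+1%:R^-1 :> R.
    move=> i.
    have [] := @rat_in_itvoo R ((v : 'cV[R]_D) i 0)
      ((v : 'cV[R]_D) i 0 + n.+1%:R^-1).
      by rewrite ltrDl.
    move=> r; rewrite in_itv/= => /andP[v1 v2]; exists r.
    by rewrite distrC ger0_norm ?subr_ge0 1?ltW// ltrBlDl.
  exists (\col_i q i, n) => //; split; last by move=> i; rewrite mxE; exact: qv.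
  move=> w Bw; apply: eU; split => // i j; rewrite (ord1 j) /ball /=.
  rewrite -(subrKA (ratr (q i))) (le_lt_trans (ler_normD _ _))// (splitr e).
  rewrite ltrD//; first exact: lt_trans ne.
  rewrite distrC; apply: lt_trans ne.
  by have := Bw i; rewrite mxE.
rewrite preimage_bigcup setTI.
apply: countable_bigcupT_measurable; first exact: countableP.
move=> q; have [qU|qU] := pselect (B q `<=` U); last first.
  by rewrite (_ : _ @^-1` _ = set0)//; apply/seteqP; split => // x [].
rewrite (_ : _ @^-1` _ = \bigcap_i ((fun t => (f t : 'cV[R]_D) i 0) @^-1`
    ball (ratr (q.1 i 0) : R) (q.2.+1%:R^-1))); last first.
  apply/seteqP; split=> [x [_ Bx] i _|x Bx].
    by rewrite /= /ball/= distrC; exact: Bx.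
  by split => // i; have := Bx i Logic.I; rewrite /= /ball/= distrC.
apply: fin_bigcap_measurable => // i _.
rewrite -[X in measurable X]setTI; apply: mf => //.
exact: measurable_realfun.measurable_ball.
Qed.

Definition consV D (yx : borelV R D * measurableTypeR R) : borelV R D.+1 :=
  col_mx (yx.2)%:M (yx.1 : 'cV[R]_D) : 'cV[R]_(1 + D).

Lemma measurable_consV D : measurable_fun setT (@consV D).
Proof.
apply: measurable_borelV => i.
case: (split_ordP (i : 'I_(1 + D))) => j ->.
  rewrite (_ : (fun _ => _) = snd); first exact: measurable_snd.
  apply/funext => -[y x] /=.
  by apply: (etrans (col_mxEu (x%:M : 'M[R]_1) _ _ _)); rewrite ord1 mxE eqxx.
rewrite (_ : (fun _ => _) = (fun v : borelV R D => (v : 'cV[R]_D) j 0) \o fst).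
  by apply: measurableT_comp; [exact: measurable_coord|exact: measurable_fst].
by apply/funext => -[y x] /=; exact: (col_mxEd (x%:M : 'M[R]_1)).
Qed.

Definition lebesgue_consV D (mu : {measure set (borelV R D) -> \bar R}) :
    set (borelV R D.+1) -> \bar R :=
  pushforward (mu \x @lebesgue_measure R)%E (@consV D).

Section lebesgue_consV_measure.
Variables (D : nat) (mu : {measure set (borelV R D) -> \bar R}).
Let mf := @measurable_consV D.
Let mu0 : lebesgue_consV mu set0 = 0%E.
Proof. exact: measure0. Qed.
Let mu_ge0 A : (0 <= lebesgue_consV mu A)%E.
Proof. exact: measure_ge0. Qed.
Let mu_sigma_additive : semi_sigma_additive (lebesgue_consV mu).
Proof. exact: measure_semi_sigma_additive. Qed.
HB.instance Definition _ := isMeasure.Build _ _ _ (lebesgue_consV mu)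
  mu0 mu_ge0 mu_sigma_additive.
End lebesgue_consV_measure.

(* D-dimensional Lebesgue measure, as the product of D copies of the          *)
(* one-dimensional one.                                                       *)
Fixpoint lebesgueV D : {measure set (borelV R D) -> \bar R} :=
  match D with
  | 0%N => [the {measure set (borelV R 0) -> \bar R} of
           dirac ((0 : 'cV[R]_0) : borelV R 0)]
  | D'.+1 => [the {measure set (borelV R D'.+1) -> \bar R} of
               lebesgue_consV (lebesgueV D')]
  end.

End lebesgue_cV.

Section gaussian.
Variables (R : realType) (D : nat).

Definition quad (A : 'M[R]_D) (v : 'cV[R]_D) : R := (v^T *m A *m v) 0 0.

Definition posdefmx (A : 'M[R]_D) : Prop :=
  A^T = A /\ forall v, v != 0 -> 0 < quad A v.

Definition gaussian_pdf (m : 'cV[R]_D) (S : 'M[R]_D) (x : 'cV[R]_D) : R :=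
  (Num.sqrt ((2 * pi) ^+ D * \det S))^-1 *
  expR (- (quad (invmx S) (x - m) / 2)).

Definition has_density d (T : measurableType d) (P : probability T R)
    (Y : T -> 'cV[R]_D) (p : 'cV[R]_D -> R) : Prop :=
  measurable_fun [set: T] (Y : T -> borelV R D) /\
  forall A : set (borelV R D), measurable A ->
    P (Y @^-1` A) = (\int[lebesgueV R D]_(x in A) (p x)%:E)%E.

Definition is_mode (p : 'cV[R]_D -> R) (m : 'cV[R]_D) : Prop :=
  forall x, x != m -> p x < p m.

End gaussian.

Section riemann.
Variables (R : realType) (D : nat).
Implicit Types (f : 'cV[R]_D -> R) (G : 'cV[R]_D -> 'M[R]_D).
Implicit Types (p q v : 'cV[R]_D).

Definition partial (i : 'I_D) f : 'cV[R]_D -> R := 'D_(delta_mx i 0) f.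

Definition grad f p : 'cV[R]_D := \col_i partial i f p.

Definition hess f p : 'M[R]_D := \matrix_(i, j) partial i (partial j f) p.

Definition grad_metric f p : 'M[R]_D := 1%:M + grad f p *m (grad f p)^T.

(* Gamma^k_{ij} of the Levi-Civita connection of the metric with coefficient  *)
(* matrix G.                                                                  *)
Definition christoffel G (k i j : 'I_D) p : R :=
  2^-1 * \sum_l invmx (G p) k l *
    (partial i (fun x => G x j l) p + partial j (fun x => G x i l) p
     - partial l (fun x => G x i j) p).

Definition is_geodesic_on G (I : set R) (c : R -> 'cV[R]_D) : Prop :=
  forall t, I t ->
  let c1 := derive1 c in
  [/\ derivable c t 1, derivable c1 t 1 &
      forall k, derive1 c1 t k 0 +
        \sum_i \sum_j christoffel G k i j (c t) * c1 t i 0 * c1 t j 0 = 0].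

(* q is the time-1 position of a geodesic, defined on an open interval        *)
(* containing [0, 1], that starts at p with velocity v.                       *)
Definition Exp_rel G p v q : Prop :=
  exists (c : R -> 'cV[R]_D) (e : R),
    [/\ 0 < e, is_geodesic_on G `](- e), (1 + e)[ c,
        c 0 = p, derive1 c 0 = v & c 1 = q].

(* Arbitrary when the geodesic does not exist up to time 1; see Exp_dom.      *)
Definition Exp G p v : 'cV[R]_D := get [set q | Exp_rel G p v q].

Definition Exp_dom G p : set 'cV[R]_D := [set v | exists q, Exp_rel G p v q].

(* Relational because the minimizer need not be unique.                       *)
Definition is_Log G p q v : Prop :=
  [/\ Exp_dom G p v, Exp G p v = q &
      forall w, Exp_dom G p w -> Exp G p w = q ->
        quad (G p) v <= quad (G p) w].

End riemann.

(* Main.v *)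
(* Both metrics are built from the gradient of the same log-density, so they  *)
(* coincide, and Exp is a left inverse of Log for a single metric.            *)

Require Import Defs.
From HB Require Import structures.
From mathcomp Require Import all_boot all_order all_algebra.
From mathcomp Require Import all_classical all_reals all_analysis.
From mathcomp Require Import ring.

Set Implicit Arguments.
Unset Strict Implicit.
Unset Printing Implicit Defensive.
Import Order.TTheory GRing.Theory Num.Theory.
Import numFieldNormedType.Exports.

Local Open Scope classical_set_scope.
Local Open Scope ring_scope.

(** For a Gaussian target, [GP] and [GM] are the same function, and [is_Log] includes
    [Exp GP m (LogP q) = q]. So the approximation map is pointwise the identity and the law of [X]
    is unchanged; no geodesic is computed. The remaining work shows that [m] is the mode and [S] the
    inverse negative Hessian: the log-density is a constant minus half a quadratic form, so its
    derivatives are read off from exact expansions ([quadD]), once [posdefmx_det_gt0] makes the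
    normalizing factor positive. *)

(** For [h != 0] the difference quotient is exactly [a + h * b], which reduces differentiation to
    algebra. *)
Lemma derive_of_quadratic_expansion (R : realType) (V : normedModType R)
    (f : V -> R) (x v : V) (a b : R) :
  (forall h : R, f (h *: v + x) = f x + h * a + h ^+ 2 * b) -> 'D_v f x = a.
Proof.
move=> fE; rewrite /derive; apply: cvg_lim => //.
have lin : (a + h * b) @[h --> (0 : R)^'] --> a.
  rewrite -[X in _ --> X]addr0 -[X in _ --> a + X](mul0r b).
  apply: cvgD; first exact: cvg_cst.
  by apply: cvgM; [exact: nbhs_dnbhs | exact: cvg_cst].
apply: cvg_trans lin; apply: near_eq_cvg.
near=> h.
have h0 : h != 0 by near: h; exact: nbhs_dnbhs_neq.
by rewrite /= fE /GRing.scale /=; field.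
Unshelve. all: by end_near. Qed.

Section positive_definite.
Variables (R : realType) (D : nat).
Implicit Types (A S : 'M[R]_D) (x y v m : 'cV[R]_D).

Lemma posdefmx_unitmx S : posdefmx S -> S \in unitmx.
Proof.
move=> [symS posS]; rewrite -row_free_unit -kermx_eq0.
apply/eqP/row_matrixP => i; rewrite row0; apply/eqP/contraT => ri0.
have := posS (row i (kermx S))^T; rewrite trmx_eq0 => /(_ ri0).
by rewrite /quad trmxK -row_mul mulmx_ker row0 mul0mx mxE ltxx.
Qed.

Lemma posdefmx1 : posdefmx (1%:M : 'M[R]_D).
Proof.
split=> [|v v0]; first by rewrite trmx1.
have sq_ge0 i : 0 <= v^T 0 i * v i 0 by rewrite mxE -expr2 sqr_ge0.
rewrite /quad mulmx1 mxE lt_def sumr_ge0 ?andbT//.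
apply: contra v0 => /eqP s0; apply/eqP/colP => i; rewrite [RHS]mxE.
have := psumr_eq0P (fun i _ => sq_ge0 i) s0 (i := i) isT.
by rewrite mxE => /eqP; rewrite -expr2 sqrf_eq0 => /eqP.
Qed.

Lemma posdefmx_segment S (t : R) : posdefmx S -> 0 <= t <= 1 ->
  posdefmx ((1 - t) *: 1%:M + t *: S).
Proof.
move=> [symS posS] /andP[t0 t1]; split.
  by rewrite linearD /= !linearZ /= trmx1 symS.
move=> v v0.
have q1 : 0 < quad 1%:M v by exact: posdefmx1.2.
have qS : 0 < quad S v by exact: posS.
have -> : quad ((1 - t) *: 1%:M + t *: S) v = (1 - t) * quad 1%:M v + t * quad S v.
  rewrite /quad mulmxDr mulmxDl -!scalemxAr -!scalemxAl mxE.
  by congr (_ + _); rewrite mxE.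
have [->|tn0] := eqVneq t 0; first by rewrite subr0 mul1r mul0r addr0.
have t_gt0 : 0 < t by rewrite lt_def tn0.
apply: ltr_wpDl; last exact: mulr_gt0.
by apply: mulr_ge0; [rewrite subr_ge0 | exact: ltW].
Qed.

(* The determinant is a polynomial without zeros along the segment from the   *)
(* identity to [S], so it keeps the sign it has at the identity.              *)
Lemma posdefmx_det_gt0 S : posdefmx S -> 0 < \det S.
Proof.
move=> pS; rewrite ltNge; apply/negP => detS.
pose p := \det ((1 - 'X) *: 1%:M + 'X *: map_mx polyC S).
have pE t : p.[t] = \det ((1 - t) *: 1%:M + t *: S).
  rewrite /p -[LHS]/(horner_eval t _) -det_map_mx; congr (\det _).
  apply/matrixP => i j; rewrite !mxE /=.
  by rewrite /horner_eval -polyC_natr !hornerE.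
(* The sign is flipped because [poly_ivt] wants a value at most 0 on the left and at least 0 on the
   right. *)
have [|t t01 /rootP] := @poly_ivt R (- p) 0 1 ler01.
  rewrite !hornerN !pE subr0 !scale1r !scale0r addr0 det1 subrr scale0r add0r.
  by rewrite oppr_le0 ler01 oppr_ge0.
rewrite hornerN => /eqP; rewrite oppr_eq0 pE => /eqP det0.
have := posdefmx_unitmx (posdefmx_segment pS t01).
by rewrite unitmxE det0 unitr0.
Qed.

(** Substituting [w = invmx S *m v] turns [quad S w] into [quad (invmx S) v]. *)
Lemma posdefmx_inv S : posdefmx S -> posdefmx (invmx S).
Proof.
move=> pS; have uS := posdefmx_unitmx pS; have [symS posS] := pS.
have symV : (invmx S)^T = invmx S by rewrite trmx_inv symS.
split=> // v v0.
have Sv0 : invmx S *m v != 0.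
  by apply: contra v0 => /eqP Sv; rewrite -(mulKVmx uS v) Sv mulmx0.
have := posS _ Sv0.
by rewrite /quad trmx_mul symV -(mulmxA _ (invmx S) S) mulVmx // mulmx1 mulmxA.
Qed.

Lemma quadD A y v (h : R) : A^T = A ->
  quad A (h *: v + y) =
  quad A y + h * (2 * (v^T *m A *m y) 0 0) + h ^+ 2 * quad A v.
Proof.
move=> symA.
have sym : (y^T *m A *m v) 0 0 = (v^T *m A *m y) 0 0.
  by rewrite -[in LHS](trmxK (y^T *m A *m v)) mxE !trmx_mul trmxK symA mulmxA.
have addE (B C : 'M[R]_1) : (B + C) 0 0 = B 0 0 + C 0 0 by rewrite mxE.
have scaleE (a : R) (B : 'M[R]_1) : (a *: B) 0 0 = a * B 0 0 by rewrite mxE.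
have trE : (h *: v + y)^T = h *: v^T + y^T
  by apply/matrixP => i j; rewrite !mxE.
rewrite /quad trE !(mulmxDl, mulmxDr) -!(scalemxAl, scalemxAr).
by rewrite !(addE, scaleE) sym; ring.
Qed.

(** Were the determinant not positive, the conventions for [Num.sqrt] and [0^-1] would make the
    density vanish identically. *)
Lemma gaussian_pdf_factor_gt0 S : posdefmx S ->
  0 < (Num.sqrt ((2 * pi) ^+ D * \det S))^-1.
Proof.
move=> pS; rewrite invr_gt0 sqrtr_gt0 mulr_gt0 ?posdefmx_det_gt0//.
by rewrite exprn_gt0// mulr_gt0 ?pi_gt0.
Qed.

Lemma is_mode_gaussian_pdf m S : posdefmx S -> is_mode (gaussian_pdf m S) m.
Proof.
move=> pS x xm; rewrite /gaussian_pdf ltr_pM2l ?gaussian_pdf_factor_gt0//.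
rewrite ltr_expR ltrN2 ltr_pM2r ?invr_gt0// subrr.
rewrite {1}/quad mulmx0 mxE.
by apply: (posdefmx_inv pS).2; rewrite subr_eq0.
Qed.

Lemma partial_ln_gaussian_pdf m S i x : posdefmx S ->
  partial i (fun y => ln (gaussian_pdf m S y)) x =
  - (invmx S *m (x - m)) i 0.
Proof.
move=> pS; have symV := (posdefmx_inv pS).1.
apply: (derive_of_quadratic_expansion
  (b := - (quad (invmx S) (delta_mx i 0) / 2))) => h.
have lnE y : ln (gaussian_pdf m S y) =
    ln (Num.sqrt ((2 * pi) ^+ D * \det S))^-1 - quad (invmx S) (y - m) / 2.
  by rewrite /gaussian_pdf lnM ?posrE ?expR_gt0 ?gaussian_pdf_factor_gt0// expRK.
rewrite !lnE -addrA quadD//.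
by rewrite -mulmxA trmx_delta -rowE [row _ _ _ _]mxE; field.
Qed.

Lemma hess_ln_gaussian_pdf m S x : posdefmx S ->
  hess (fun y => ln (gaussian_pdf m S y)) x = - invmx S.
Proof.
move=> pS; apply/matrixP => i j; rewrite !mxE.
rewrite (_ : partial j _ = fun y => - (invmx S *m (y - m)) j 0); last first.
  by apply/funext => y; exact: partial_ln_gaussian_pdf.
(* The gradient is affine, so there is no second-order term; symmetry of [invmx S] then swaps the
   indices of the entry obtained. *)
apply: (derive_of_quadratic_expansion (b := 0)) => h.
have symV : invmx S j i = invmx S i j by rewrite -[in LHS](posdefmx_inv pS).1 mxE.
have addE (u v : 'cV[R]_D) : (u + v) j 0 = u j 0 + v j 0 by rewrite mxE.
have scaleE (u : 'cV[R]_D) : (h *: u) j 0 = h * u j 0 by rewrite mxE.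
rewrite -addrA mulmxDr -scalemxAr -colE addE scaleE [col _ _ _ _]mxE symV; ring.
Qed.

End positive_definite.

Theorem mainTheorem4 (R : realType) (D : nat)
    (m : 'cV[R]_D) (S : 'M[R]_D) (posS : posdefmx S)
    (target : 'cV[R]_D -> R) (target_gaussian : target = gaussian_pdf m S)
    (ell : 'cV[R]_D -> R) (ellE : ell = (fun x => ln (target x)))
    (GP GM : 'cV[R]_D -> 'M[R]_D)
    (GPE : GP = grad_metric (fun x => ln (gaussian_pdf m S x)))
    (GME : GM = grad_metric ell) :
  [/\ is_mode target m,
      S = invmx (- hess ell m) &
      forall (LogP : 'cV[R]_D -> 'cV[R]_D)
             (LogP_spec : forall q, is_Log GP m q (LogP q))
             (d : measure_display) (T : measurableType d)
             (P : probability T R) (X : T -> 'cV[R]_D),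
        has_density P X (gaussian_pdf m S) ->
        has_density P (fun w => Exp GM m (LogP (X w))) target].
Proof.
subst target ell GP GM; split.
- exact: is_mode_gaussian_pdf.
- by rewrite hess_ln_gaussian_pdf// opprK invmxK.
- move=> LogP LogP_spec d T P X XP.
  (* After [subst] the two metrics agree, so the [Exp] clause of [is_Log] applies to [GM]
     directly. *)
  rewrite (_ : (fun w => _) = X)//.
  by apply/funext => w; have [] := LogP_spec (X w).
Qed.
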